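(* Every two-qubit quantum computation $U\in U(4)$ can be realized exactly, up to a global phase, by a circuit of at most $23$ elementary gates, of which at most $4$ are CNOT gates; that is, there exist $c\in\mathbb{C}$ with $|c|=1$ and elementary gates $G_1,\dots,G_m$ with $m\le 23$, at most $4$ of them CNOTs, such that $U=c\,G_m G_{m-1}\cdots G_1$. No ancilla qubits are used.
   Context: Two-qubit computations are $4\times4$ unitary matrices acting on $\mathbb{C}^2\otimes\mathbb{C}^2$ with computational basis $|00\rangle,|01\rangle,|10\rangle,|11\rangle$ in this order. The elementary gates are the $4\times 4$ matrices of the following forms: $R_y(\theta)\otimes \mathbf{1}$ or $\mathbf{1}\otimes R_y(\theta)$, where $R_y(\theta)=\begin{pmatrix}\cos\theta/2 & \sin\theta/2\\ -\sin\theta/2 & \cos\theta/2\end{pmatrix}$, $0\le\theta<2\pi$; $R_z(\alpha)\otimes\mathbf{1}$ or $\mathbf{1}\otimes R_z(\alpha)$, where $R_z(\alpha)=\mathrm{diag}(e^{-i\alpha/2},e^{i\alpha/2})$, $0\le\alpha<2\pi$; and the two CNOT gates, namely the permutation matrix swapping $|10\rangle\leftrightarrow|11\rangle$ and the permutation matrix swapping $|01\rangle\leftrightarrow|11\rangle$ (each fixing the other basis vectors). A circuit computes the product of its gate matrices. *)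

(* Defs.v *)
From HB Require Import structures.
From mathcomp Require Import all_boot all_order all_algebra.
From mathcomp Require Import reals trigo.
From mathcomp Require Import fingroup perm complex mxtens.

Set Implicit Arguments.
Unset Strict Implicit.
Unset Printing Implicit Defensive.

Import Order.TTheory GRing.Theory Num.Theory.
Local Open Scope ring_scope.
Local Open Scope complex_scope.

Section Gates.
Variable R : realType.
Local Notation C := R[i].

Definition expi (phi : R) : C := (cos phi) +i* (sin phi).

Definition Ry (theta : R) : 'M[C]_2 :=
  \matrix_(a < 2, b < 2)
    (if a == b then (cos (theta / 2))%:C
     else if (a == 0 :> nat) then (sin (theta / 2))%:C
     else (- sin (theta / 2))%:C).

Definition Rz (alpha : R) : 'M[C]_2 :=
  \matrix_(a < 2, b < 2)
    (if a == b then (if (a == 0 :> nat) then expi (- (alpha / 2)) else expi (alpha / 2))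
     else 0).

(* Kronecker product on C^2 (x) C^2 with basis |00>,|01>,|10>,|11>
   (index 2*a + b, the ordering of tensmx). *)
Definition kron (A B : 'M[C]_2) : 'M[C]_4 := tensmx A B.

Definition idx (k : nat) (Hk : (k < 4)%N) : 'I_4 := Ordinal Hk.

Definition swap_mx (i j : 'I_4) : 'M[C]_4 := perm_mx (tperm i j).

(* CNOT swapping |10> <-> |11>  (control qubit 1, target qubit 2) *)
Definition cnot12 : 'M[C]_4 := swap_mx (@idx 2 isT) (@idx 3 isT).
(* CNOT swapping |01> <-> |11>  (control qubit 2, target qubit 1) *)
Definition cnot21 : 'M[C]_4 := swap_mx (@idx 1 isT) (@idx 3 isT).

Definition is_cnot (G : 'M[C]_4) : bool := (G == cnot12) || (G == cnot21).

Definition elementary_gate (G : 'M[C]_4) : Prop :=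
  (exists theta : R, 0 <= theta < 2 * pi /\
     (G = kron (Ry theta) 1%:M \/ G = kron 1%:M (Ry theta))) \/
  (exists alpha : R, 0 <= alpha < 2 * pi /\
     (G = kron (Rz alpha) 1%:M \/ G = kron 1%:M (Rz alpha))) \/
  is_cnot G.

Definition circuit (gs : seq 'M[C]_4) : 'M[C]_4 :=
  foldr (fun G acc => acc *m G) 1%:M gs.

Definition adjoint (U : 'M[C]_4) : 'M[C]_4 := (map_mx (@conjc R) U)^T.

Definition unitary (U : 'M[C]_4) : Prop := U *m adjoint U = 1%:M.

End Gates.

(* Main.v *)
(* In the magic basis [E] (Bell states up to phases) conjugation by [E] turns
   SO(4) into SU(2) (x) SU(2). Writing [E^* U E = O1 D O2^T] with [O1], [O2] real
   orthogonal and [D] diagonal unitary makes [U] a local gate, times [E D' E^*],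
   times a local gate. Each [O] is a product of reflections, and a reflection is
   a local gate times quaternion conjugation, which is diagonal in the magic
   basis; this diagonal sign matrix goes into [D'], so no determinant is ever
   computed. Local gates cost 2 * 3 rotations by Euler angles. The phases of [E]
   cancel in [E D' E^*], leaving the Bell circuit CNOT * Ry around a diagonal
   gate Rz * Rz * CNOT * Rz * CNOT: the total is 6 + 2 + 5 + 2 + 6 = 21 gates, 4
   of them CNOTs. Rotations are handled through points of the unit circle instead
   of angles, signs being global phases. *)
Require Import Defs.
From HB Require Import structures.
From mathcomp Require Import all_boot all_order all_algebra.
From mathcomp Require Import reals trigo.
From mathcomp Require Import fingroup perm complex mxtens.
From mathcomp Require Import spectral ring lra.
Import Order.TTheory GRing.Theory Num.Theory.
Local Open Scope ring_scope.
Local Open Scope complex_scope.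

Set Implicit Arguments.
Unset Strict Implicit.
Unset Printing Implicit Defensive.

(** * Reflections and real diagonalisation *)

Section RealOrthogonal.
Variable C : numClosedFieldType.
Implicit Types n : nat.

(** * Entrywise conjugation and real orthogonal matrices *)

Definition mxconj {m n} (A : 'M[C]_(m, n)) : 'M[C]_(m, n) := map_mx Num.conj A.
Definition real_mx {m n} (A : 'M[C]_(m, n)) := mxconj A = A.
Definition rorthomx {n} (A : 'M[C]_n) := A *m A^T = 1%:M /\ real_mx A.

Lemma mxconjM m n p (A : 'M[C]_(m, n)) (B : 'M_(n, p)) :
  mxconj (A *m B) = mxconj A *m mxconj B.
Proof. exact: map_mxM. Qed.

Lemma mxconjK m n (A : 'M[C]_(m, n)) : mxconj (mxconj A) = A.
Proof. by apply/matrixP=> i j; rewrite !mxE conjCK. Qed.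

Lemma mxconj1 n : mxconj (1%:M : 'M[C]_n) = 1%:M.
Proof. exact: map_mx1. Qed.

Lemma mxconj_tr m n (A : 'M[C]_(m, n)) : mxconj A^T = (mxconj A)^T.
Proof. exact/esym/map_trmx. Qed.

Lemma real_mxM m n p (A : 'M[C]_(m, n)) (B : 'M_(n, p)) :
  real_mx A -> real_mx B -> real_mx (A *m B).
Proof. by rewrite /real_mx mxconjM => -> ->. Qed.

Lemma real_mx_tr m n (A : 'M[C]_(m, n)) : real_mx A -> real_mx A^T.
Proof. by rewrite /real_mx mxconj_tr => ->. Qed.

Lemma real_mx_row m n (A : 'M[C]_(m, n)) i : real_mx A -> real_mx (row i A).
Proof. by rewrite /real_mx /mxconj map_row => ->. Qed.

Lemma real_mxZ m n r (A : 'M[C]_(m, n)) :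
  Num.conj r = r -> real_mx A -> real_mx (r *: A).
Proof. by rewrite /real_mx /mxconj map_mxZ /= => -> ->. Qed.

Lemma rorthomxM n (A B : 'M[C]_n) : rorthomx A -> rorthomx B -> rorthomx (A *m B).
Proof.
move=> [A1 Ar] [B1 Br]; split; last exact: real_mxM.
by rewrite trmx_mul mulmxA -[A *m B *m _]mulmxA B1 mulmx1.
Qed.

Lemma rorthomx_tr n (A : 'M[C]_n) : rorthomx A -> rorthomx A^T.
Proof.
by move=> [A1 Ar]; split; [rewrite trmxK; apply: mulmx1C | apply: real_mx_tr].
Qed.

Lemma rorthomx1 n : rorthomx (1%:M : 'M[C]_n).
Proof. by split; [rewrite trmx1 mulmx1 | apply: mxconj1]. Qed.

Lemma rV_sqr_eq0 n (w : 'rV[C]_n) : w *m (mxconj w)^T = 0 -> w = 0.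
Proof.
move/matrixP/(_ 0 0); rewrite !mxE.
under eq_bigr => i _ do rewrite !mxE -normCK.
move/(psumr_eq0P (fun i _ => exprn_ge0 2 (normr_ge0 (w 0 i)))) => w0.
apply/rowP=> i; rewrite mxE; apply/eqP.
by rewrite -normr_eq0 -sqrf_eq0 w0.
Qed.

(** For real [w] the bilinear square [w *m w^T] is the Hermitian norm, hence positive, and its
    inverse square root is a real scaling factor. *)
Lemma real_rV_normalize n (w : 'rV[C]_n) : real_mx w -> w != 0 ->
  exists2 r, r != 0 /\ Num.conj r = r & r ^+ 2 *: (w *m w^T) = 1%:M.
Proof.
move=> wr w0; set s := (w *m w^T) 0 0.
have sE : s = \sum_i `|w 0 i| ^+ 2.
  rewrite /s mxE; apply: eq_bigr => i _.
  by move/matrixP/(_ 0 i): wr; rewrite !mxE normCK => ->.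
have s_ge0 : 0 <= s by rewrite sE sumr_ge0 // => i _; rewrite exprn_ge0.
have ws : w *m w^T = s%:M by apply: mx11_scalar.
have s0 : s != 0.
  apply: contra w0 => /eqP s0; apply/eqP/rV_sqr_eq0.
  by rewrite wr ws s0 raddf0.
exists (sqrtC s)^-1; first split.
- by rewrite invr_eq0 sqrtC_eq0.
- by apply: conj_Creal; rewrite ger0_real // invr_ge0 sqrtC_ge0.
- by rewrite ws exprVn sqrtCK scale_scalar_mx mulVf.
Qed.

(** * Householder reflections *)

Definition refl {n} (a : 'rV[C]_n) : 'M[C]_n := 1%:M - 2 *: (a^T *m a).

Lemma refl_tr n (a : 'rV[C]_n) : (refl a)^T = refl a.
Proof. by rewrite /refl linearB /= linearZ /= trmx1 trmx_mul trmxK. Qed.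

Lemma refl_sqr n (a : 'rV[C]_n) : a *m a^T = 1%:M -> refl a *m refl a = 1%:M.
Proof.
move=> a1; rewrite /refl mulmxBr mulmx1 mulmxBl mul1mx -scalemxAl -scalemxAr.
rewrite !mulmxA -[_ *m a *m a^T]mulmxA a1 mulmx1 scalerA opprB addrACA -opprD.
by apply/matrixP => i j; rewrite !mxE; ring.
Qed.

Lemma rorthomx_refl n (a : 'rV[C]_n) :
  a *m a^T = 1%:M -> real_mx a -> rorthomx (refl a).
Proof.
move=> a1 ar; split; first by rewrite refl_tr refl_sqr.
rewrite /real_mx /refl /mxconj raddfB /= map_mxZ -/(mxconj _) mxconj1.
by rewrite -/(mxconj _) (real_mxM (real_mx_tr ar) ar) rmorph_nat.
Qed.

(** The mirror vector is the normalised [w = u - v]: as [u] and [v] have equal length,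
    [2 (u w^T) = w w^T], so [u] moves to [v], while vectors orthogonal to [w] stay fixed. *)
Lemma refl_exchange n (u v : 'rV[C]_n) :
  real_mx u -> real_mx v -> u *m u^T = 1%:M -> v *m v^T = 1%:M -> u != v ->
  exists a, [/\ real_mx a, a *m a^T = 1%:M, u *m refl a = v &
    forall x : 'rV_n, x *m u^T = x *m v^T -> x *m refl a = x].
Proof.
move=> ur vr u1 v1 uv; pose w := u - v.
have wr : real_mx w by rewrite /real_mx /mxconj raddfB /= -!/(mxconj _) ur vr.
have [|r [r0 rr] rw] := real_rV_normalize wr; first by rewrite subr_eq0.
have aE (x : 'rV_n) : x *m refl (r *: w) = x - (2 * r ^+ 2) *: ((x *m w^T) *m w).
  rewrite /refl mulmxBr mulmx1 [(r *: w)^T]linearZ /=.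
  by rewrite -!(scalemxAr, scalemxAl) !scalerA mulmxA expr2 mulrA.
exists (r *: w); split.
- exact: real_mxZ.
- by rewrite linearZ /= -scalemxAl -scalemxAr scalerA -expr2.
- rewrite aE; suff -> : (2 * r ^+ 2) *: ((u *m w^T) *m w) = w.
    by rewrite /w opprB addrC subrK.
  have uvT : u *m v^T = v *m u^T.
    by rewrite [LHS]mx11_scalar -tr_scalar_mx -mx11_scalar trmx_mul trmxK.
  have -> : 2 * r ^+ 2 = r ^+ 2 * 2 by rewrite mulrC.
  rewrite -scalerA scalemxAl.
  suff -> : 2 *: (u *m w^T) = w *m w^T by rewrite scalemxAl rw mul1mx.
  rewrite /w [(u - v)^T]linearB /= mulmxBl !mulmxBr u1 v1 uvT.
  by apply/matrixP => i j; rewrite !mxE; ring.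
- move=> x xuv; rewrite aE /w [(u - v)^T]linearB /= [x *m _]mulmxBr xuv subrr mul0mx scaler0.
  by rewrite subr0.
Qed.

Lemma delta_unit n (i : 'I_n) :
  (delta_mx 0 i : 'rV[C]_n) *m (delta_mx 0 i)^T = 1%:M.
Proof.
rewrite trmx_delta mul_delta_mx; apply/matrixP => a b.
by rewrite !mxE !ord1 eqxx.
Qed.

Lemma real_delta m n i j : real_mx (delta_mx i j : 'M[C]_(m, n)).
Proof. by apply/matrixP => a b; rewrite !mxE conjC_nat. Qed.

Lemma rorthomx_first_row n (u : 'rV[C]_n.+1) : real_mx u -> u *m u^T = 1%:M ->
  exists2 H : 'M_n.+1, rorthomx H & delta_mx 0 0 *m H = u.
Proof.
move=> ur u1; have [<-|due] := eqVneq (delta_mx 0 0) u.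
  by exists 1%:M; [apply: rorthomx1 | rewrite mulmx1].
have [a [ar a1 <- _]] :=
  refl_exchange (real_delta _ _) ur (delta_unit _) u1 due.
by exists (refl a); first apply: rorthomx_refl.
Qed.

(** Cartan-Dieudonne as an induction principle: at most one reflection per row turns that row into a
    basis vector, until the identity is left. *)
Lemma rorthomx_refl_ind n (P : 'M[C]_n -> Prop) :
  P 1%:M ->
  (forall A a, real_mx a -> a *m a^T = 1%:M -> P A -> P (A *m refl a)) ->
  forall A, rorthomx A -> P A.
Proof.
move=> P1 PM.
(* [k] bounds the number of rows still to be treated; the rows before [n - k] are already basis
   vectors. *)
suff PA k A : rorthomx A -> (forall i : 'I_n, (i < n - k)%N -> row i A = delta_mx 0 i) ->
    P A by move=> A Ao; apply: (PA n) => // i; rewrite subnn.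
elim: k A => [|k IHk] A Ao Ae.
  suff -> : A = 1%:M by [].
  by apply/row_matrixP => i; rewrite Ae ?subn0 // row1.
(* For [n <= k] the truncated difference [n - k] is [0], so the induction hypothesis asks nothing of
   the rows. *)
have [nk|kn] := leqP n k.
  by apply: IHk => // i; move: nk; rewrite /leq => /eqP ->.
have nkn : (n - k.+1 < n)%N by rewrite ltn_subrL (leq_ltn_trans _ kn).
pose i0 := Ordinal nkn.
have iS (i : 'I_n) : (i < n - k)%N -> i != i0 -> (i < n - k.+1)%N.
  rewrite -(subnSK kn) ltnS leq_eqVlt => /orP[/eqP ii|//].
  by move=> /eqP[]; apply: val_inj.
have [/eqP Ai0|Ai0] := boolP (row i0 A == delta_mx 0 i0).
  by apply: IHk => // i ik; have [->//|/(iS _ ik)/Ae] := eqVneq i i0.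
have Arow i j : row i A *m (row j A)^T = (i == j)%:R%:M.
  have /matrixP/(_ i j) := Ao.1; rewrite !mxE => Aij.
  apply/matrixP => x y; rewrite !ord1 !mxE -Aij.
  by apply: eq_bigr => l _; rewrite !mxE.
have [|||||a [ar a1 aA aP]] := @refl_exchange _ (row i0 A) (delta_mx 0 i0).
- exact/real_mx_row/Ao.2.
- exact: real_delta.
- by rewrite Arow eqxx.
- exact: delta_unit.
- by [].
(* A reflection is its own inverse, so [A] is recovered from [A *m refl a]. *)
rewrite -[A]mulmx1 -(refl_sqr a1) mulmxA; apply: PM => //.
apply: IHk => [|i ik]; first by apply: rorthomxM => //; apply: rorthomx_refl.
rewrite row_mul; have [->//|ii] := eqVneq i i0.
(* Treated rows are orthogonal to row [i0], by orthogonality of [A], and to the basis vector of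
   index [i0], so the reflection fixes them. *)
have iA := Ae _ (iS _ ik ii); rewrite aP // {1}iA -?{1}iA //.
rewrite Arow (negPf ii) raddf0 iA trmx_delta mul_delta_mx_0 //.
Qed.

(* [u] and its conjugate are eigenvectors for the same eigenvalue, since the
   conjugate of [M] is its inverse; so are the real and imaginary parts. *)
Lemma sym_unitary_real_eigen n (M : 'M[C]_n.+1) :
  M^T = M -> M *m mxconj M = 1%:M ->
  exists l (u : 'rV_n.+1), [/\ real_mx u, u *m u^T = 1%:M & u *m M = l *: u].
Proof.
move=> Ms Mu; have [l /eigenvalueP[v vM v0]] := eigenvalue_closed M (ltn0Sn n).
suff [w [wr w0 wM]] : exists w : 'rV_n.+1, [/\ real_mx w, w != 0 & w *m M = l *: w].
  have [r [r0 rr] rw] := real_rV_normalize wr w0.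
  exists l, (r *: w); split; first exact: real_mxZ.
  - by rewrite [(r *: w)^T]linearZ /= -scalemxAr -scalemxAl scalerA -expr2.
  - by rewrite -scalemxAl wM !scalerA mulrC.
have cvM : mxconj v *m mxconj M = Num.conj l *: mxconj v.
  by rewrite -mxconjM vM /mxconj map_mxZ.
(* [M] preserves the Hermitian norm, so the eigenvalue has modulus 1. *)
have ll : Num.conj l * l = 1.
  have : (v *m M) *m (mxconj (v *m M))^T = v *m (mxconj v)^T.
    rewrite mxconjM trmx_mul -mulmxA [M *m _]mulmxA -[(mxconj M)^T]mxconj_tr Ms Mu.
    by rewrite mul1mx.
  rewrite vM /mxconj map_mxZ -/(mxconj _) [(_ *: mxconj v)^T]linearZ /=.
  rewrite -scalemxAr -scalemxAl scalerA => /eqP.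
  rewrite -subr_eq0 -{2}[v *m _]scale1r -scalerBl scaler_eq0 subr_eq0.
  by case/orP => [/eqP //|/eqP/rV_sqr_eq0 ve]; rewrite ve eqxx in v0.
have vM' : mxconj v *m M = l *: mxconj v.
  have Mu' := mulmx1C Mu.
  have : mxconj v *m mxconj M *m M = mxconj v by rewrite -mulmxA Mu' mulmx1.
  rewrite cvM -scalemxAl => {2}<-.
  by rewrite scalerA [l * _]mulrC ll scale1r.
(* Twice the real part of [v] serves unless it vanishes; then [v] is purely imaginary and ['i *: v]
   serves. *)
have [vr|vr] := eqVneq (v + mxconj v) 0; last first.
  exists (v + mxconj v); split => //; last by rewrite mulmxDl vM vM' scalerDr.
  by rewrite /real_mx /mxconj raddfD /= -!/(mxconj _) mxconjK addrC.
exists ('i *: v); split; last by rewrite -scalemxAl vM !scalerA mulrC.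
  rewrite /real_mx /mxconj map_mxZ /= conjCi -/(mxconj _).
  by move/eqP: vr; rewrite addr_eq0 scaleNr -scalerN => /eqP {2}->.
by rewrite scaler_eq0 negb_or neq0Ci.
Qed.

(** Deflation: a real unit eigenvector, completed to an orthogonal [H], splits off one diagonal
    entry, and the remaining block is again symmetric and unitary. *)
Lemma sym_unitary_diag n (M : 'M[C]_n) : M^T = M -> M *m mxconj M = 1%:M ->
  exists2 O : 'M_n, rorthomx O & is_diag_mx (O *m M *m O^T).
Proof.
elim: n M => [|n IHn] M Ms Mu.
  by exists 1%:M; [apply: rorthomx1 | apply/is_diag_mxP => -[]].
have [l [u [ur u1 uM]]] := sym_unitary_real_eigen Ms Mu.
have [H Ho Hu] := rorthomx_first_row ur u1.
have HH := mulmx1C Ho.1.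
have [N NE] : exists N : 'M_(1 + n), N = H *m M *m H^T by eexists.
have Ns : N^T = N by rewrite NE !trmx_mul trmxK Ms mulmxA.
have Nu : N *m mxconj N = 1%:M.
  rewrite NE !mxconjM mxconj_tr Ho.2 -!mulmxA [H^T *m _]mulmxA HH mul1mx.
  by rewrite [M *m _]mulmxA Mu mul1mx Ho.1.
(* [H] sends the first basis vector to the eigenvector [u], so row [0] of [N] is [l] times that
   basis vector; symmetry then clears column [0]. *)
have N0 j : N 0 (rshift 1 j) = 0.
  have : row 0 N = l *: delta_mx 0 0.
    rewrite rowE NE !mulmxA Hu uM -Hu -!scalemxAl -mulmxA Ho.1.
    by rewrite mulmx1.
  by move/rowP/(_ (rshift 1 j)); rewrite !mxE /= mulr0.
have Nur : ursubmx N = 0.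
  by apply/matrixP => i j; rewrite !mxE !ord1 -[RHS](N0 j); congr (N _ _); apply: val_inj.
have Ndl : dlsubmx N = 0 by rewrite -[N]Ns -trmx_ursub Nur trmx0.
have Nb : N = block_mx (ulsubmx N) 0 0 (drsubmx N).
  by rewrite -[LHS]submxK Nur Ndl.
have [||O [O1 Or] Od] := IHn (drsubmx N).
- by rewrite trmx_drsub Ns.
- move: Nu; rewrite Nb /mxconj map_block_mx map_mx0 mulmx_block.
  rewrite (scalar_mx_block 1 n) => /eq_block_mx[_ _ _].
  by rewrite mul0mx add0r block_mxKdr.
pose B : 'M[C]_(1 + n) := block_mx 1%:M 0 0 O.
have BT : B^T = block_mx 1%:M 0 0 O^T by rewrite tr_block_mx trmx1 !trmx0.
have Bo : rorthomx B.
  split.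
    rewrite BT /B mulmx_block !(mulmx0, mul0mx, mulmx1, addr0, add0r) O1.
    by rewrite -scalar_mx_block.
  rewrite /real_mx /mxconj map_block_mx /= !map_mx0 -!/(mxconj _) Or.
  by rewrite mxconj1.
exists (B *m H); first exact: rorthomxM.
have -> : B *m H *m M *m (B *m H)^T = B *m N *m B^T.
  by rewrite NE trmx_mul !mulmxA.
suff: @is_diag_mx _ (1 + n) (1 + n) (B *m N *m B^T) by [].
rewrite Nb BT /B !mulmx_block !(mulmx0, mul0mx, mulmx1, mul1mx, addr0, add0r).
rewrite is_diag_block_mx // !eqxx Od andbT /=.
by rewrite [ulsubmx N]mx11_scalar scalar_mx_is_diag.
Qed.

(* [O2] diagonalises the symmetric unitary [U^T U], and
   [d] collects square roots of its eigenvalues. *)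
Lemma unitary_orth_diag_orth n (U : 'M[C]_n) : U *m (mxconj U)^T = 1%:M ->
  exists O1 O2 (d : 'rV_n), [/\ rorthomx O1, rorthomx O2,
    forall i, d 0 i * Num.conj (d 0 i) = 1 & U = O1 *m diag_mx d *m O2^T].
Proof.
move=> Uu; have UU := mulmx1C Uu.
have [M ME] : exists M, M = U^T *m U by eexists.
have Ms : M^T = M by rewrite ME trmx_mul trmxK.
have Mu : M *m mxconj M = 1%:M.
  rewrite ME mxconjM mxconj_tr mulmxA -[_ *m U *m _]mulmxA Uu mulmx1.
  by apply: trmx_inj; rewrite trmx_mul trmxK UU trmx1.
have [O [O1 Or] /is_diag_mxP Od] := sym_unitary_diag Ms Mu.
have OO := mulmx1C O1.
have [D DE] : exists D, D = O *m M *m O^T by eexists.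
rewrite -DE in Od.
pose d : 'rV[C]_n := \row_i sqrtC (D i i).
pose e : 'rV[C]_n := \row_i Num.conj (d 0 i).
have dd : D = diag_mx d *m diag_mx d.
  rewrite mulmx_diag; apply/matrixP => i j; rewrite !mxE.
  by have [->|ij] := eqVneq i j; [rewrite mulr1n -expr2 sqrtCK | rewrite mulr0n Od].
have Du : D *m mxconj D = 1%:M.
  rewrite DE !mxconjM mxconj_tr Or -!mulmxA [O^T *m _]mulmxA OO mul1mx.
  by rewrite [M *m _]mulmxA Mu mul1mx.
have d1 i : d 0 i * Num.conj (d 0 i) = 1.
  move/matrixP/(_ i i): Du; rewrite {1}dd {1}dd mxconjM mulmx_diag.
  rewrite /mxconj !map_diag_mx !mulmx_diag !mxE eqxx !mulr1n /=.
  rewrite mulrACA -!normCK -expr2 => /eqP.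
  by rewrite pexpr_eq1 // ?exprn_ge0 // => /eqP.
have ed : diag_mx d *m diag_mx e = 1%:M.
  rewrite mulmx_diag; apply/matrixP => i j; rewrite !mxE.
  by case: eqP => [->|_]; rewrite ?mulr0n // mulr1n -[RHS](d1 j) !mxE.
have de := mulmx1C ed.
(* [X] is both unitary and complex orthogonal, so [X^T] is its conjugate transpose and [X] is
   real. *)
pose X := U *m O^T *m diag_mx e.
have XX : X^T *m X = 1%:M.
  rewrite /X !trmx_mul tr_diag_mx trmxK -!mulmxA [U^T *m _]mulmxA -ME.
  transitivity (diag_mx e *m D *m diag_mx e); first by rewrite DE !mulmxA.
  by rewrite dd mulmxA de mul1mx ed.
have Xu : X *m (mxconj X)^T = 1%:M.
  rewrite /X !mxconjM mxconj_tr Or !trmx_mul trmxK.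
  rewrite -!mulmxA [diag_mx e *m _]mulmxA.
  have -> : (mxconj (diag_mx e))^T = diag_mx d.
    rewrite /mxconj map_diag_mx tr_diag_mx; congr diag_mx.
    by apply/rowP => i; rewrite !mxE; apply: conjCK.
  by rewrite de mul1mx [O^T *m _]mulmxA OO mul1mx.
exists X, O^T, d; split.
- split; first exact: mulmx1C.
  have : X^T *m (X *m (mxconj X)^T) = (mxconj X)^T by rewrite mulmxA XX mul1mx.
  by rewrite Xu mulmx1 => /(congr1 trmx); rewrite !trmxK.
- exact: rorthomx_tr.
- exact: d1.
- by rewrite trmxK /X -!mulmxA [diag_mx e *m _]mulmxA de mul1mx OO mulmx1.
Qed.

End RealOrthogonal.

(** * Explicit small matrices *)

Section SmallMatrices.
Variable S : comNzRingType.

(** Matrices are given by tables of entries, so that products reduce by computation and matrix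
    identities become ring identities on entries. *)
Definition mx2 (a b c d : S) : 'M[S]_2 :=
  \matrix_(i < 2, j < 2) nth 0 (nth [::] [:: [:: a; b]; [:: c; d]] i) j.
Definition mx4 (s : seq (seq S)) : 'M[S]_4 :=
  \matrix_(i < 4, j < 4) nth 0 (nth [::] s i) j.

Lemma ord2P (P : 'I_2 -> Prop) : P 0 -> P 1 -> forall i, P i.
Proof.
move=> P0 P1 [[|[|m]] h] //; first by congr P: P0; apply: val_inj.
by congr P: P1; apply: val_inj.
Qed.

Lemma ord4P (P : 'I_4 -> Prop) :
  P (@idx 0 isT) -> P (@idx 1 isT) -> P (@idx 2 isT) -> P (@idx 3 isT) ->
  forall i, P i.
Proof.
move=> P0 P1 P2 P3 [[|[|[|[|m]]]] h] //.
- by congr P: P0; apply: val_inj.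
- by congr P: P1; apply: val_inj.
- by congr P: P2; apply: val_inj.
- by congr P: P3; apply: val_inj.
Qed.

Lemma mx2_eta (A : 'M[S]_2) : A = mx2 (A 0 0) (A 0 1) (A 1 0) (A 1 1).
Proof. by apply/matrixP; elim/ord2P; elim/ord2P; rewrite !mxE. Qed.

Lemma mx2_mul a b c d a' b' c' d' : mx2 a b c d *m mx2 a' b' c' d' =
  mx2 (a * a' + b * c') (a * b' + b * d') (c * a' + d * c') (c * b' + d * d').
Proof.
by apply/matrixP; elim/ord2P; elim/ord2P; rewrite !mxE big_ord_recl big_ord1 !mxE.
Qed.

Lemma mx2_scale k a b c d : k *: mx2 a b c d = mx2 (k * a) (k * b) (k * c) (k * d).
Proof. by apply/matrixP; elim/ord2P; elim/ord2P; rewrite !mxE. Qed.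

Lemma mx2_1 : 1%:M = mx2 1 0 0 1.
Proof. by apply/matrixP; elim/ord2P; elim/ord2P; rewrite !mxE. Qed.

Lemma mx2_tr a b c d : (mx2 a b c d)^T = mx2 a c b d.
Proof. by apply/matrixP; elim/ord2P; elim/ord2P; rewrite !mxE. Qed.

Lemma mx2_inj a b c d a' b' c' d' : mx2 a b c d = mx2 a' b' c' d' ->
  [/\ a = a', b = b', c = c' & d = d'].
Proof.
move/matrixP=> e.
by split; [move: (e 0 0) | move: (e 0 1) | move: (e 1 0) | move: (e 1 1)];
  rewrite !mxE.
Qed.

Lemma mx4_mul s t : mx4 s *m mx4 t =
  mx4 (mkseq (fun i => mkseq (fun j =>
    (nth [::] s i)`_0 * (nth [::] t 0)`_j + (nth [::] s i)`_1 * (nth [::] t 1)`_j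
    + (nth [::] s i)`_2 * (nth [::] t 2)`_j
    + (nth [::] s i)`_3 * (nth [::] t 3)`_j) 4) 4).
Proof.
apply/matrixP=> i j; rewrite !mxE !big_ord_recl big_ord0 !mxE addr0 !addrA.
by rewrite !nth_mkseq ?ltn_ord.
Qed.

Lemma mx4_scale k s : k *: mx4 s =
  mx4 (mkseq (fun i => mkseq (fun j => k * (nth [::] s i)`_j) 4) 4).
Proof. by apply/matrixP=> i j; rewrite !mxE !nth_mkseq ?ltn_ord. Qed.

Lemma mx4_1 : 1%:M =
  mx4 [:: [:: 1; 0; 0; 0]; [:: 0; 1; 0; 0]; [:: 0; 0; 1; 0]; [:: 0; 0; 0; 1]].
Proof. by apply/matrixP; elim/ord4P; elim/ord4P; rewrite !mxE. Qed.

Lemma tensmx2 a b c d a' b' c' d' :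
  tensmx (mx2 a b c d) (mx2 a' b' c' d') =
  mx4 [:: [:: a * a'; a * b'; b * a'; b * b']; [:: a * c'; a * d'; b * c'; b * d'];
          [:: c * a'; c * b'; d * a'; d * b']; [:: c * c'; c * d'; d * c'; d * d']].
Proof. by apply/matrixP; elim/ord4P; elim/ord4P; rewrite !mxE. Qed.

Definition diag4 (a b c d : S) : 'M[S]_4 :=
  mx4 [:: [:: a; 0; 0; 0]; [:: 0; b; 0; 0]; [:: 0; 0; c; 0]; [:: 0; 0; 0; d]].

Lemma diag_mx4 (d : 'rV[S]_4) : diag_mx d =
  diag4 (d 0 (@idx 0 isT)) (d 0 (@idx 1 isT)) (d 0 (@idx 2 isT)) (d 0 (@idx 3 isT)).
Proof. by apply/matrixP; elim/ord4P; elim/ord4P; rewrite !mxE. Qed.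

Lemma diag4_mul a b c d a' b' c' d' : diag4 a b c d *m diag4 a' b' c' d' =
  diag4 (a * a') (b * b') (c * c') (d * d').
Proof.
rewrite /diag4 mx4_mul /mkseq /=.
by rewrite !(mul0r, mulr0, add0r, addr0).
Qed.

Lemma diag4_scale k a b c d :
  k *: diag4 a b c d = diag4 (k * a) (k * b) (k * c) (k * d).
Proof. by rewrite mx4_scale /mkseq /= !mulr0. Qed.

Lemma tensmx_diag2 a b c d : tensmx (mx2 a 0 0 b) (mx2 c 0 0 d) =
  diag4 (a * c) (a * d) (b * c) (b * d).
Proof. by rewrite tensmx2 !(mul0r, mulr0). Qed.

Definition swap23 : 'M[S]_4 :=
  mx4 [:: [:: 1; 0; 0; 0]; [:: 0; 1; 0; 0]; [:: 0; 0; 0; 1]; [:: 0; 0; 1; 0]].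

(** Conjugating a rotation of the second qubit by a CNOT thus yields a phase that depends only on
    the parity of the two bits. *)
Lemma diag4_swap23 a b c d :
  swap23 *m diag4 a b c d *m swap23 = diag4 a b d c.
Proof.
rewrite /diag4 /swap23 !mx4_mul /mkseq /=.
by rewrite !(mul0r, mulr0, mulr1, mul1r, add0r, addr0).
Qed.

(* On a 2x2 matrix read as the vector of its entries, [adj4] is the adjugate
   and [tensmx A B] is [X |-> A *m X *m B^T]. *)
Definition adj4 : 'M[S]_4 :=
  mx4 [:: [:: 0; 0; 0; 1]; [:: 0; -1; 0; 0]; [:: 0; 0; -1; 0]; [:: 1; 0; 0; 0]].

Definition col4 (a b c d : S) : 'cV[S]_4 := \col_(i < 4) [:: a; b; c; d]`_i.

Lemma col4_mul a b c d a' b' c' d' :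
  col4 a b c d *m (col4 a' b' c' d')^T =
  mx4 (mkseq (fun i => mkseq (fun j =>
    [:: a; b; c; d]`_i * [:: a'; b'; c'; d']`_j) 4) 4).
Proof.
apply/matrixP => i j.
by rewrite mxE big_ord1 !mxE !nth_mkseq ?ltn_ord.
Qed.

Lemma mulmx_adj4 (s : seq (seq S)) : mx4 s *m adj4 =
  mx4 (mkseq (fun i => let r := nth [::] s i in [:: r`_3; - r`_1; - r`_2; r`_0]) 4).
Proof.
rewrite mx4_mul /mkseq /=.
by rewrite !(mul0r, mulr0, mulr1, mulrN1, add0r, addr0).
Qed.

(* [X - <X, q> q = - q (adj X) q] for [det q = 1]. *)
Lemma quaternion_refl p p' s s' : p * p' + s * s' = 1 ->
  1%:M - col4 p s (- s') p' *m (col4 p' s' (- s) p)^T =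
  (tensmx (mx2 (- p) (- s) s' (- p')) (mx2 p (- s') s p') : 'M[S]_4) *m adj4.
Proof.
move=> ps1; rewrite tensmx2 mulmx_adj4 col4_mul.
rewrite -[1%:M]scale1r -{1}ps1 mx4_1 mx4_scale.
apply/matrixP; elim/ord4P; elim/ord4P; rewrite !mxE /=; ring.
Qed.

Lemma col4_eta (v : 'cV[S]_4) : v =
  col4 (v (@idx 0 isT) 0) (v (@idx 1 isT) 0) (v (@idx 2 isT) 0) (v (@idx 3 isT) 0).
Proof. by apply/matrixP; elim/ord4P => j; rewrite !mxE ord1. Qed.

Lemma mx4_col4 s a b c d : mx4 s *m col4 a b c d =
  let f i := let r := nth [::] s i in r`_0 * a + r`_1 * b + r`_2 * c + r`_3 * d in
  col4 (f 0) (f 1) (f 2) (f 3).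
Proof.
apply/matrixP; elim/ord4P => j;
by rewrite !mxE !big_ord_recl big_ord0 !mxE /= addr0 !addrA.
Qed.

(** * The Bell basis over an arbitrary ring *)

(** The columns are Bell states, left unnormalised so that no square root of 2 enters; their order
    is the one produced in [bell_circuit]. *)
Definition bell : 'M[S]_4 :=
  mx4 [:: [:: 1; 0; 1; 0]; [:: 0; 1; 0; 1]; [:: 0; -1; 0; 1]; [:: -1; 0; 1; 0]].

Lemma bell_ortho : bell *m bell^T = 2 *: 1%:M.
Proof.
have -> : bell^T = mx4
    [:: [:: 1; 0; 0; -1]; [:: 0; 1; -1; 0]; [:: 1; 0; 0; 1]; [:: 0; 1; 1; 0]].
  by apply/matrixP; elim/ord4P; elim/ord4P; rewrite !mxE.
rewrite mx4_1 mx4_mul mx4_scale.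
by apply/matrixP; elim/ord4P; elim/ord4P; rewrite !mxE /=; ring.
Qed.

(** Read as 2x2 matrices, the third column is the identity and the others are traceless; the
    adjugate [tr X - X] fixes the former and negates the latter. *)
Lemma bell_adj : adj4 *m bell = bell *m diag4 (-1) (-1) 1 (-1).
Proof.
rewrite !mx4_mul.
by apply/matrixP; elim/ord4P; elim/ord4P; rewrite !mxE /=; ring.
Qed.

Lemma bell_circuit r :
  swap23 *m (tensmx (mx2 r r (- r) r) (1%:M : 'M_2) : 'M_4) = r *: bell.
Proof.
rewrite mx2_1 tensmx2 mx4_mul mx4_scale.
by apply/matrixP; elim/ord4P; elim/ord4P; rewrite !mxE /=; ring.
Qed.

End SmallMatrices.

(** * Circuits and the magic basis *)

Section Circuits.
Variable R : realType.
Local Notation C := R[i].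
Implicit Types U V W : 'M[C]_4.

Lemma cnot12E : cnot12 R =
  swap23 C.
Proof. by apply/matrixP; elim/ord4P; elim/ord4P; rewrite !mxE permE. Qed.

Lemma cnot21E : cnot21 R =
  mx4 [:: [:: 1; 0; 0; 0]; [:: 0; 0; 0; 1]; [:: 0; 0; 1; 0]; [:: 0; 1; 0; 0]].
Proof. by apply/matrixP; elim/ord4P; elim/ord4P; rewrite !mxE permE. Qed.

(** CNOTs are counted by equality of matrices, so local gates must be told apart from them. A zero
    entry of a tensor product forces a factor to vanish, and this kills another entry which is [1]
    in the CNOT. *)
Lemma kron_not_cnot (A B : 'M[C]_2) : ~~ is_cnot (kron A B).
Proof.
rewrite /is_cnot cnot12E cnot21E /swap23 (mx2_eta A) (mx2_eta B) /kron tensmx2.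
have n10 : (1 : C) <> 0 by apply/eqP; rewrite oner_eq0.
apply/negP => /orP[]/eqP/matrixP e.
- move: (e (@idx 0 isT) (@idx 0 isT)) (e (@idx 2 isT) (@idx 2 isT))
    (e (@idx 2 isT) (@idx 3 isT)).
  rewrite !mxE /= => e0 /eqP; rewrite mulf_eq0 => /orP[]/eqP e1.
    by rewrite e1 mul0r => /esym.
  by move: e0; rewrite e1 mulr0 => /esym.
- move: (e (@idx 0 isT) (@idx 0 isT)) (e (@idx 1 isT) (@idx 1 isT))
    (e (@idx 3 isT) (@idx 1 isT)).
  rewrite !mxE /= => e0 /eqP; rewrite mulf_eq0 => /orP[]/eqP e1.
    by move: e0; rewrite e1 mul0r => /esym.
  by rewrite e1 mulr0 => /esym.
Qed.

Lemma unit_normP (z : C) : reflect (z * Num.conj z = 1) (`|z| == 1).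
Proof.
rewrite -[z * Num.conj z]/(z * Num.conj z) -normCK -(@pexpr_eq1 _ _ 2) //.
exact: eqP.
Qed.

(** * Gate budgets *)

(** Both budgets are upper bounds and the global phase is built in, so that budgets simply add under
    products. *)
Definition realizable (n k : nat) U :=
  exists (c : C) (gs : seq 'M[C]_4),
    `|c| = 1 /\ (forall G, G \in gs -> elementary_gate G) /\
    (size gs <= n)%N /\ (count (@is_cnot R) gs <= k)%N /\ U = c *: circuit gs.

Lemma circuit_cat (s t : seq 'M[C]_4) : circuit (s ++ t) = circuit t *m circuit s.
Proof. by elim: s => [|G s IHs] /=; rewrite ?mulmx1 // IHs mulmxA. Qed.

Lemma realizableM n1 k1 n2 k2 U V : realizable n1 k1 U -> realizable n2 k2 V ->
  realizable (n1 + n2) (k1 + k2) (U *m V).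
Proof.
move=> [c [s [c1 [sE [sn [sk ->]]]]]] [d [t [d1 [tE [tn [tk ->]]]]]].
(* The head of a gate list acts first, so the gates of the right factor [V] come first. *)
exists (c * d), (t ++ s); rewrite normrM c1 d1 mulr1; split=> //; split.
  by move=> G; rewrite mem_cat => /orP[/tE|/sE].
rewrite size_cat count_cat addnC leq_add //; split=> //.
rewrite addnC leq_add //; split=> //.
by rewrite circuit_cat -scalemxAl -scalemxAr scalerA.
Qed.

Lemma realizableZ n k (c : C) U : `|c| = 1 -> realizable n k U ->
  realizable n k (c *: U).
Proof.
move=> c1 [d [s [d1 [sE [sn [sk ->]]]]]].
by exists (c * d), s; rewrite normrM c1 d1 mulr1 scalerA.
Qed.

Lemma realizable_gate G : elementary_gate G -> realizable 1 (is_cnot G) G.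
Proof.
move=> Gg; exists 1, [:: G]; rewrite normr1 scale1r /circuit /= mul1mx addn0.
by do !split=> //; move=> H; rewrite inE => /eqP ->.
Qed.

Lemma realizable_cnot12 : realizable 1 1 (cnot12 R).
Proof.
have /realizable_gate : elementary_gate (cnot12 R).
  by right; right; rewrite /is_cnot eqxx.
by rewrite /is_cnot eqxx.
Qed.

(** * One-qubit rotations and Euler angles *)

Definition ry (x y : R) : 'M[C]_2 := mx2 x%:C y%:C (- y%:C) x%:C.
Definition rz (z : C) : 'M[C]_2 := mx2 (Num.conj z) 0 0 z.

(* The half-angle of an elementary rotation ranges over [0, pi), which reaches
   every point of the unit circle only up to sign. *)
Lemma half_angle (x y : R) : x ^+ 2 + y ^+ 2 = 1 ->
  exists (t s : R), [/\ 0 <= t < 2 * pi, s ^+ 2 = 1,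
    x = s * cos (t / 2) & y = s * sin (t / 2)].
Proof.
(* A point of the lower half plane is replaced by its antipode, which flips [s]. *)
move=> xy1; wlog y0 : x y xy1 / 0 <= y => [IH|].
  have [/IH|y0] := leP 0 y; first exact.
  have [||t [s [t0 s1 xE yE]]] := IH (- x) (- y); first by rewrite !sqrrN.
    by rewrite oppr_ge0 ltW.
  exists t, (- s); split=> //; first by rewrite sqrrN.
    by rewrite mulNr -xE opprK.
  by rewrite mulNr -yE opprK.
have x2 : x ^+ 2 <= 1 by rewrite -xy1 lerDl sqr_ge0.
have xb : -1 <= x <= 1 by apply/andP; split; nra.
have sinE : sin (acos x) = y.
  by rewrite sin_acos // -xy1 addrC addKr sqrtr_sqr ger0_norm.
have half (u : R) : 2 * u / 2 = u by rewrite mulrAC mulfV ?mul1r // pnatr_eq0.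
(* Here the half angle would be [pi], hence [t = 2 * pi], which is excluded; [t = 0] with sign [-1]
   gives the same point. *)
have [xN1|xN1] := eqVneq x (-1).
  exists 0, (-1); rewrite mul0r cos0 sin0 mulr1 mulr0 lexx mulr_gt0 ?pi_gt0 //.
  split=> //; first by rewrite sqrrN expr1n.
  move/eqP: xy1; rewrite xN1 sqrrN expr1n -subr_eq0 addrAC subrr add0r.
  by rewrite sqrf_eq0 => /eqP.
exists (2 * acos x), 1; rewrite half !mul1r sinE acosK //; split=> //.
- rewrite mulr_ge0 ?acos_ge0 // ltr_pM2l // acos_ltpi //.
  by move/andP: xb => [xb ->]; rewrite lt_neqAle eq_sym xN1 xb.
- by rewrite expr1n.
Qed.

Lemma kronM (A B A' B' : 'M[C]_2) :
  kron (A *m A') (B *m B') = kron A B *m kron A' B'.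
Proof. have /esym := @tensmx_mul C 2 2 2 2 2 2 A B A' B'; exact. Qed.

Lemma kronZl c (A B : 'M[C]_2) : kron (c *: A) B = c *: kron A B.
Proof. by apply/matrixP=> i j; rewrite !mxE mulrA. Qed.

Lemma kronZr c (A B : 'M[C]_2) : kron A (c *: B) = c *: kron A B.
Proof. by apply/matrixP=> i j; rewrite !mxE mulrCA. Qed.

Lemma conj_real (x : R) : Num.conj x%:C = x%:C.
Proof. exact: conjc_real. Qed.

Lemma conjM (a b : C) : Num.conj (a * b) = Num.conj a * Num.conj b.
Proof. exact: rmorphM. Qed.

Lemma norm_sign (s : R) : s ^+ 2 = 1 -> `|s%:C| = 1.
Proof.
by move=> s1; apply/eqP/unit_normP; rewrite conj_real -rmorphM -expr2 s1.
Qed.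

Lemma realizable_kron (A B : 'M[C]_2) : elementary_gate (kron A B) ->
  realizable 1 0 (kron A B).
Proof. by move/realizable_gate; rewrite (negPf (kron_not_cnot _ _)). Qed.

Lemma realizable_ry (x y : R) : x ^+ 2 + y ^+ 2 = 1 ->
  realizable 1 0 (kron (ry x y) 1%:M) /\ realizable 1 0 (kron 1%:M (ry x y)).
Proof.
move=> /half_angle[t [s [t0 s1 -> ->]]].
have -> : ry (s * cos (t / 2)) (s * sin (t / 2)) = s%:C *: Ry t.
  apply/matrixP; elim/ord2P; elim/ord2P; rewrite !mxE /= -?rmorphM //.
  by rewrite -rmorphN mulrN.
rewrite kronZl kronZr; have s1' := norm_sign s1.
by split; apply: realizableZ => //; apply: realizable_kron;
  left; exists t; split; auto.
Qed.

Lemma realizable_rz (z : C) : `|z| = 1 ->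
  realizable 1 0 (kron (rz z) 1%:M) /\ realizable 1 0 (kron 1%:M (rz z)).
Proof.
case: z => x y /eqP/unit_normP z1.
have /half_angle[t [s [t0 s1 -> ->]]] : x ^+ 2 + y ^+ 2 = 1.
  by move: z1 => /(congr1 (@complex.Re _)) /= <-; ring.
have -> : rz ((s * cos (t / 2)) +i* (s * sin (t / 2))) = s%:C *: Rz t.
  apply/matrixP; elim/ord2P; elim/ord2P; rewrite !mxE /= ?mulr0 //.
  - by rewrite /expi cosN sinN; apply/eqP; rewrite eq_complex /=; apply/andP; split; apply/eqP; ring.
  - by rewrite /expi; apply/eqP; rewrite eq_complex /=; apply/andP; split; apply/eqP; ring.
rewrite kronZl kronZr; have s1' := norm_sign s1.
by split; apply: realizableZ => //; apply: realizable_kron;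
  right; left; exists t; split; auto.
Qed.

Lemma unit_conj (z : C) : `|z| = 1 -> Num.conj z = z^-1.
Proof.
move=> z1; have z0 : z != 0 by rewrite -normr_eq0 z1 oner_eq0.
by apply: (mulfI z0); rewrite mulfV //; apply/unit_normP/eqP.
Qed.

Lemma unit_neq0 (z : C) : `|z| = 1 -> z != 0.
Proof. by move=> z1; rewrite -normr_eq0 z1 oner_eq0. Qed.

Lemma norm_sqrtC (z : C) : `|z| = 1 -> `|sqrtC z| = 1.
Proof.
move=> z1; apply/eqP; rewrite -(@pexpr_eq1 _ _ 2) // -normrX sqrtCK.
by rewrite z1.
Qed.

Lemma polar (z : C) : exists (x : R) (u : C), `|u| = 1 /\ z = x%:C * u.
Proof.
have [->|z0] := eqVneq z 0; first by exists 0, 1; rewrite normr1 mul0r.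
exists (complex.Re `|z|), (z / `|z|); split.
  by rewrite normrM normfV normr_id mulfV // normr_eq0.
by rewrite RRe_real ?normr_real // mulrCA mulfV ?mulr1 // normr_eq0.
Qed.

Definition unitary2 (A : 'M[C]_2) := A *m (mxconj A)^T = 1%:M.

Lemma conj_mx2 (a b c d : C) : mxconj (mx2 a b c d) = mx2 (Num.conj a) (Num.conj b) (Num.conj c) (Num.conj d).
Proof. by apply/matrixP; elim/ord2P; elim/ord2P; rewrite !mxE. Qed.

(** The second row is determined by the first and the determinant [e]. The moduli of [a] and [b]
    give the middle rotation, and the phases of [a], [b] and [e] give the three unit scalars. *)
Lemma unitary2_ZYZ (A : 'M[C]_2) : unitary2 A ->
  exists (c z w : C) (x y : R), [/\ `|c| = 1, `|z| = 1, `|w| = 1,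
    x ^+ 2 + y ^+ 2 = 1 & A = c *: (rz z *m ry x y *m rz w)].
Proof.
rewrite /unitary2 (mx2_eta A); move: (A 0 0) (A 0 1) (A 1 0) (A 1 1) => a b c d.
rewrite conj_mx2 mx2_tr mx2_mul mx2_1 => /mx2_inj[ab1 abcd cdab cd1].
pose e := a * d - b * c.
have dE : d = e * Num.conj a.
  transitivity (d * (a * Num.conj a + b * Num.conj b) - b * (c * Num.conj a + d * Num.conj b)); last first.
    by rewrite /e; ring.
  by rewrite ab1 cdab mulr0 mulr1 subr0.
have cE : c = - (e * Num.conj b).
  transitivity (c * (a * Num.conj a + b * Num.conj b) - a * (c * Num.conj a + d * Num.conj b)); last first.
    by rewrite /e; ring.
  by rewrite ab1 cdab mulr0 mulr1 subr0.
have e1 : `|e| = 1.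
  apply/eqP/unit_normP; rewrite -cd1 cE dE !rmorphN !rmorphM /= !conjCK.
  by rewrite -[LHS]mulr1 -{1}ab1; ring.
have [k [k1 ke]] : exists k : C, `|k| = 1 /\ e = k * k.
  by exists (sqrtC e); rewrite norm_sqrtC // -expr2 sqrtCK.
have [x [u [u1 aE]]] := polar a; have [y [v [v1 bE]]] := polar b.
have [g [g1 guv]] : exists g : C, `|g| = 1 /\ u * v = g * g.
  by exists (sqrtC (u * v)); rewrite norm_sqrtC -?expr2 ?sqrtCK // normrM u1 v1 mulr1.
have [u0 v0 k0 g0] := And4 (unit_neq0 u1) (unit_neq0 v1) (unit_neq0 k1) (unit_neq0 g1).
have uE : u = g * g / v by rewrite -guv mulfK.
(* These solve [k * conj z * conj w = u] and [k * conj z * w = v], using [g * g = u * v]. *)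
exists k, (k / g), (v / g), x, y; split=> //.
- by rewrite normrM normfV k1 g1 divr1.
- by rewrite normrM normfV v1 g1 divr1.
- move: ab1; rewrite aE bE !conjM (unit_conj u1) (unit_conj v1) !conj_real.
  rewrite (mulrACA x%:C) (mulrACA y%:C) !mulfV // !mulr1.
  by move/(congr1 (@complex.Re _)) => /= <-; ring.
- rewrite /rz /ry !mx2_mul mx2_scale cE dE aE bE ke.
  have gk : `|k / g| = 1 by rewrite normrM normfV k1 g1 divr1.
  have gv : `|v / g| = 1 by rewrite normrM normfV v1 g1 divr1.
  rewrite (unit_conj gk) (unit_conj gv) !conjM !conj_real.
  rewrite (unit_conj u1) (unit_conj v1) uE.
  by congr mx2; field; rewrite ?k0 ?g0 ?v0.
Qed.

Lemma realizable_local (A B : 'M[C]_2) : unitary2 A -> unitary2 B ->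
  realizable 6 0 (kron A B).
Proof.
move=> /unitary2_ZYZ[c [z [w [x [y [c1 z1 w1 xy1 ->]]]]]].
move=> /unitary2_ZYZ[c' [z' [w' [x' [y' [c1' z1' w1' xy1' ->]]]]]].
rewrite kronZl kronZr; apply: realizableZ => //; apply: realizableZ => //.
have kl (X Y : 'M[C]_2) : kron (X *m Y) 1%:M = kron X 1%:M *m kron Y 1%:M.
  by rewrite -kronM mulmx1.
have kr (X Y : 'M[C]_2) : kron 1%:M (X *m Y) = kron 1%:M X *m kron 1%:M Y.
  by rewrite -kronM mulmx1.
rewrite -[X in kron X]mulmx1 -[X in kron _ X]mul1mx kronM.
apply: (@realizableM 3 0 3 0).
  rewrite !kl; apply: (@realizableM 2 0 1 0); last exact: (realizable_rz w1).1.
  apply: (@realizableM 1 0 1 0); last exact: (realizable_ry xy1).1.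
  exact: (realizable_rz z1).1.
rewrite !kr; apply: (@realizableM 2 0 1 0); last exact: (realizable_rz w1').2.
apply: (@realizableM 1 0 1 0); last exact: (realizable_ry xy1').2.
exact: (realizable_rz z1').2.
Qed.

(** * Diagonal gates *)

(** Four phases are matched by four parameters: a global phase [k], one rotation on each qubit, and
    a parity phase [y] made of a rotation between two CNOTs. *)
Lemma realizable_diag (d : 'rV[C]_4) : (forall i, `|d 0 i| = 1) ->
  realizable 5 2 (diag_mx d).
Proof.
move=> d1; rewrite diag_mx4.
move: (d1 (@idx 0 isT)) (d1 (@idx 1 isT)) (d1 (@idx 2 isT)) (d1 (@idx 3 isT)).
move: (d 0 (@idx 0 isT)) (d 0 (@idx 1 isT)) (d 0 (@idx 2 isT)) (d 0 (@idx 3 isT)).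
move=> a b c e a1 b1 c1 e1.
pose p := sqrtC (a * b); pose q := sqrtC (c * e); pose k := sqrtC (p * q).
pose y := sqrtC (b * c / (p * q)).
have p1 : `|p| = 1 by rewrite norm_sqrtC // normrM a1 b1 mulr1.
have q1 : `|q| = 1 by rewrite norm_sqrtC // normrM c1 e1 mulr1.
have k1 : `|k| = 1 by rewrite norm_sqrtC // normrM p1 q1 mulr1.
have y1 : `|y| = 1.
  by rewrite norm_sqrtC // normrM normfV !normrM b1 c1 p1 q1 !mulr1 divr1.
have [p0 q0 k0 y0] := And4 (unit_neq0 p1) (unit_neq0 q1) (unit_neq0 k1) (unit_neq0 y1).
have b0 := unit_neq0 b1; have c0 := unit_neq0 c1.
(* Everything is expressed through [p], [k], [b], [y] by relations between squares only, so the
   choice of the square roots is irrelevant. *)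
have aE : a = p ^+ 2 / b by rewrite sqrtCK mulfK.
have eE : e = q ^+ 2 / c by rewrite sqrtCK mulrC mulKf.
have qE : q = k ^+ 2 / p by rewrite sqrtCK mulrC mulKf.
have cE : c = y ^+ 2 * k ^+ 2 / b.
  by rewrite !sqrtCK mulfVK ?mulf_neq0 // mulrC mulKf.
have z1 : `|k / p| = 1 by rewrite normrM normfV k1 p1 divr1.
have w1 : `|b / (p * y)| = 1 by rewrite normrM normfV normrM b1 p1 y1 !mulr1 divr1.
clearbody p q k y.
have -> : diag4 a b c e =
  k *: (kron (rz (k / p)) 1%:M *m kron 1%:M (rz (b / (p * y)))
    *m (cnot12 R *m kron 1%:M (rz y) *m cnot12 R)).
  rewrite /rz (unit_conj z1) (unit_conj w1) (unit_conj y1) cnot12E mx2_1.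
  rewrite /kron !tensmx_diag2 diag4_swap23 !diag4_mul diag4_scale.
  rewrite eE qE cE aE; clear - p0 k0 b0 y0.
  by congr diag4; field; rewrite ?p0 ?k0 ?b0 ?y0.
apply: realizableZ => //.
apply: (@realizableM 2 0 3 2).
  apply: (@realizableM 1 0 1 0); last exact: (realizable_rz w1).2.
  exact: (realizable_rz z1).1.
apply: (@realizableM 2 1 1 1); last exact: realizable_cnot12.
apply: (@realizableM 1 1 1 0); last exact: (realizable_rz y1).2.
exact: realizable_cnot12.
Qed.

(** * Adjoints and the normalised Bell circuit *)

(** Convertible to [adjoint] in dimension 4, but available in every dimension. *)
Definition dag n (A : 'M[C]_n) : 'M[C]_n := (mxconj A)^T.

Lemma dagM n (A B : 'M[C]_n) : dag (A *m B) = dag B *m dag A.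
Proof. by rewrite /dag mxconjM trmx_mul. Qed.

Lemma dagK n (A : 'M[C]_n) : dag (dag A) = A.
Proof. by rewrite /dag mxconj_tr trmxK mxconjK. Qed.

Lemma dag_kron (A B : 'M[C]_2) : dag (kron A B) = kron (dag A) (dag B).
Proof.
apply/matrixP; elim/ord4P; elim/ord4P; rewrite /dag /kron !mxE; exact: conjM.
Qed.

Lemma dag_unitary n (A : 'M[C]_n) : A *m dag A = 1%:M -> dag A *m dag (dag A) = 1%:M.
Proof. by rewrite dagK => /mulmx1C. Qed.

Lemma dag_diag n (d : 'rV[C]_n) : dag (diag_mx d) = diag_mx (mxconj d).
Proof. by rewrite /dag /mxconj map_diag_mx tr_diag_mx. Qed.

Definition rsqrt2 : R := (Num.sqrt 2)^-1.

Lemma rsqrt2_sqr : rsqrt2 ^+ 2 = 2^-1.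
Proof. by rewrite exprVn sqr_sqrtr. Qed.

Definition bellC : 'M[C]_4 := rsqrt2%:C *: bell C.

Lemma bellC_circuit : bellC = cnot12 R *m kron (ry rsqrt2 rsqrt2) 1%:M.
Proof. by rewrite cnot12E /kron /ry bell_circuit. Qed.

Lemma bellC_tr : dag bellC = bellC^T.
Proof.
rewrite /bellC /dag /mxconj map_mxZ; congr (_ *: _)^T; first exact: conj_real.
by apply/matrixP; elim/ord4P; elim/ord4P; rewrite !mxE /= ?rmorphN ?rmorph1 ?rmorph0.
Qed.

Lemma bellC_unitary : bellC *m dag bellC = 1%:M.
Proof.
rewrite bellC_tr /bellC linearZ /= -scalemxAl -scalemxAr bell_ortho !scalerA.
rewrite -rmorphM -expr2 rsqrt2_sqr -[RHS]scale1r; congr (_ *: _).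
by rewrite fmorphV rmorph_nat mulVf // pnatr_eq0.
Qed.

Lemma realizable_bellC : realizable 2 1 bellC /\ realizable 2 1 (dag bellC).
Proof.
have rr : rsqrt2 ^+ 2 + rsqrt2 ^+ 2 = 1 by rewrite rsqrt2_sqr; field.
have rr' : rsqrt2 ^+ 2 + (- rsqrt2) ^+ 2 = 1 by rewrite sqrrN.
split; first rewrite bellC_circuit.
  apply: (@realizableM 1 1 1 0); first exact: realizable_cnot12.
  exact: (realizable_ry rr).1.
(* Taking adjoints reverses the circuit: the CNOT is real symmetric, and the rotation changes the
   sign of its sine. *)
have -> : dag bellC = kron (ry rsqrt2 (- rsqrt2)) 1%:M *m cnot12 R.
  rewrite bellC_circuit dagM dag_kron; congr (kron _ _ *m _).
  - rewrite /dag /ry conj_mx2 mx2_tr; congr mx2; rewrite ?conj_real //.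
    + by rewrite -rmorphN conj_real rmorphN.
    + by rewrite rmorphN opprK.
  - by rewrite /dag mxconj1 trmx1.
  - rewrite /dag cnot12E; apply/matrixP; elim/ord4P; elim/ord4P;
      by rewrite !mxE /= ?rmorph1 ?rmorph0.
apply: (@realizableM 1 0 1 1); last exact: realizable_cnot12.
exact: (realizable_ry rr').1.
Qed.

(** * The magic basis *)

(** With these phases the Bell columns become, up to normalisation, [iZ], [iY], [1], [iX] for the
    Pauli matrices, a real basis of the quaternions. *)
Definition phase : 'rV[C]_4 := \row_i [:: 'i; 1; 1; 'i]`_i.
Definition magic : 'M[C]_4 := bellC *m diag_mx phase.
(** Quaternion conjugation in the magic basis; the [1] marks the scalar unit. *)
Definition signs : 'rV[C]_4 := \row_i [:: -1; -1; 1; -1]`_i.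

Lemma phaseE : diag_mx phase = diag4 'i 1 1 'i :> 'M[C]_4.
Proof. by rewrite diag_mx4 !mxE. Qed.

Lemma signsE : diag_mx signs = diag4 (-1) (-1) 1 (-1) :> 'M[C]_4.
Proof. by rewrite diag_mx4 !mxE. Qed.

Lemma phase_norm i : `|phase 0 i| = 1.
Proof. by elim/ord4P: i; rewrite mxE /= ?normCi ?normr1. Qed.

Lemma signs_norm i : `|signs 0 i| = 1.
Proof. by elim/ord4P: i; rewrite mxE /= ?normrN ?normr1. Qed.

Lemma diag_unitary n (d : 'rV[C]_n) : (forall i, `|d 0 i| = 1) ->
  diag_mx d *m dag (diag_mx d) = 1%:M.
Proof.
move=> d1; rewrite dag_diag mulmx_diag; apply/matrixP=> i j; rewrite !mxE.
by case: eqP => // _; rewrite mulr1n -normCK d1 expr1n.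
Qed.

Lemma magic_unitary : magic *m dag magic = 1%:M.
Proof.
rewrite /magic dagM -mulmxA [diag_mx _ *m _]mulmxA diag_unitary ?mul1mx.
  exact: bellC_unitary.
exact: phase_norm.
Qed.

Lemma bellC_adj : adj4 C *m bellC = bellC *m diag_mx signs.
Proof.
transitivity (rsqrt2%:C *: (adj4 C *m bell C)); first by rewrite scalemxAr.
by rewrite bell_adj scalemxAl signsE.
Qed.

Lemma magic_signs : magic *m diag_mx signs = adj4 C *m magic.
Proof.
rewrite /magic mulmxA bellC_adj -!mulmxA; congr (_ *m _).
by rewrite diag_mxC.
Qed.

Lemma conj_addi (x y : R) : Num.conj (x%:C + 'i * y%:C) = x%:C - 'i * y%:C :> C.
Proof. by rewrite rmorphD rmorphM /= conjCi !conj_real mulNr. Qed.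

(* [magic] maps a real vector to a multiple of the quaternion [[p, s], [- s^*, p^*]]. *)
Lemma magic_refl (a : 'rV[C]_4) : real_mx a -> a *m a^T = 1%:M ->
  exists A B, [/\ unitary2 A, unitary2 B &
    magic *m refl a = kron A B *m magic *m diag_mx signs].
Proof.
move=> ar a1.
have ax i : exists x : R, a 0 i = x%:C.
  move/matrixP/(_ 0 i): ar; rewrite !mxE => /CrealP /RRe_real <-.
  by exists (complex.Re (a 0 i)).
have [x0 xE0] := ax (@idx 0 isT); have [x1 xE1] := ax (@idx 1 isT).
have [x2 xE2] := ax (@idx 2 isT); have [x3 xE3] := ax (@idx 3 isT).
pose p : C := x2%:C + 'i * x0%:C; pose s : C := x1%:C + 'i * x3%:C.
pose p' := Num.conj p; pose s' := Num.conj s.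
have ps : p * p' + s * s' = 1.
  (* A polynomial identity in a free ['i]; the last term vanishes because ['i ^+ 2 = -1]. *)
  have -> : p * p' + s * s' = x0%:C * x0%:C + x1%:C * x1%:C + x2%:C * x2%:C
      + x3%:C * x3%:C - ('i ^+ 2 + 1) * (x0%:C * x0%:C + x3%:C * x3%:C).
    by rewrite /p' /s' !conj_addi /p /s; ring.
  rewrite sqrCi addNr mul0r subr0.
  have <- : (a *m a^T) 0 0 = 1 by rewrite a1 mxE.
  rewrite mxE !big_ord_recl big_ord0 addr0 !mxE -xE0 -xE1 -xE2 -xE3 !addrA.
  by do !congr (_ + _); congr (a 0 _ * a 0 _); apply: val_inj.
have aT : a^T = col4 x0%:C x1%:C x2%:C x3%:C.
  by rewrite [LHS]col4_eta !mxE xE0 xE1 xE2 xE3.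
have va : magic *m a^T = rsqrt2%:C *: col4 p s (- s') p'.
  rewrite aT /magic /bellC -!scalemxAl -mulmxA phaseE !mx4_col4 /=.
  congr (_ *: col4 _ _ _ _); rewrite /p' /s' ?conj_addi /p /s; ring.
have dv : (mxconj (col4 p s (- s') p'))^T = (col4 p' s' (- s) p)^T.
  congr (_^T); apply/matrixP; elim/ord4P => j; rewrite !mxE //=.
    by rewrite rmorphN; congr (- _); apply: conjCK.
  exact: conjCK.
have aM : a *m dag magic = rsqrt2%:C *: (col4 p' s' (- s) p)^T.
  rewrite -dv -[in LHS]ar -[a]trmxK /dag mxconj_tr -trmx_mul -mxconjM va.
  by rewrite /mxconj map_mxZ linearZ /= conj_real.
(* For [q] the quaternion with entries [p], [s], [- s'], [p'], these are [- q] and [q^T], so their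
   tensor product acts as [X |-> - q X q]. *)
exists (mx2 (- p) (- s) s' (- p')), (mx2 p (- s') s p'); split.
- rewrite /unitary2 conj_mx2 mx2_tr mx2_mul mx2_1 !rmorphN /= /s' /p' !conjCK -/p' -/s'.
  by congr mx2; rewrite -?ps; ring.
- rewrite /unitary2 conj_mx2 mx2_tr mx2_mul mx2_1 !rmorphN /= /s' /p' !conjCK -/p' -/s'.
  by congr mx2; rewrite -?ps; ring.
have magic1 := mulmx1C magic_unitary.
rewrite -mulmxA magic_signs mulmxA /kron -(quaternion_refl ps).
(* Conjugated by [magic], the reflection is [1] minus a rank-one matrix; the two factors [rsqrt2]
   cancel the [2] in [refl]. *)
transitivity (magic *m refl a *m dag magic *m magic).
  by rewrite -[RHS]mulmxA magic1 mulmx1.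
congr (_ *m _).
rewrite /refl mulmxBr mulmx1 mulmxBl magic_unitary; congr (_ - _).
have vv : magic *m (a^T *m a) *m dag magic =
    (magic *m a^T) *m (a *m dag magic) by rewrite !mulmxA.
rewrite -scalemxAr -scalemxAl vv va aM -scalemxAl -scalemxAr !scalerA.
rewrite -mulrA -rmorphM -expr2 rsqrt2_sqr fmorphV rmorph_nat.
by rewrite mulfV ?scale1r // pnatr_eq0.
Qed.

Lemma signs_sqr : diag_mx signs *m diag_mx signs = 1%:M.
Proof. by rewrite signsE diag4_mul mx4_1; congr diag4; ring. Qed.

(** The sign matrix is an orthogonal involution, so conjugating a reflection by it only moves the
    mirror vector. *)
Lemma signs_refl (a : 'rV[C]_4) :
  diag_mx signs *m refl a = refl (a *m diag_mx signs) *m diag_mx signs.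
Proof.
rewrite /refl mulmxBr mulmxBl mulmx1 mul1mx; congr (_ - _).
rewrite trmx_mul tr_diag_mx -scalemxAr -scalemxAl -!mulmxA signs_sqr mulmx1.
by [].
Qed.

Lemma unitary2M (A B : 'M[C]_2) : unitary2 A -> unitary2 B -> unitary2 (A *m B).
Proof.
rewrite /unitary2 => A1 B1; rewrite mxconjM trmx_mul mulmxA.
by rewrite -[A *m B *m _]mulmxA B1 mulmx1.
Qed.

(** Induction over reflections. Each one yields a local gate and a sign matrix; the accumulated [K]
    alternates between [1] and [diag_mx signs], and passes the next reflection by [signs_refl]. *)
Lemma magic_rorthomx (X : 'M[C]_4) : rorthomx X -> exists A B (e : 'rV[C]_4),
  [/\ unitary2 A, unitary2 B, forall i, `|e 0 i| = 1 &
    magic *m X = kron A B *m magic *m diag_mx e].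
Proof.
pose P (Y : 'M[C]_4) := exists A B (K : 'M[C]_4), [/\ unitary2 A, unitary2 B,
    K = 1%:M \/ K = diag_mx signs & magic *m Y = kron A B *m magic *m K].
move=> Xo; suff [A [B [K [Au Bu Ke XE]]]] : P X.
  exists A, B; case: Ke XE => -> ->; [exists (const_mx 1)|exists signs]; split=> //.
  - by move=> i; rewrite mxE normr1.
  - by rewrite diag_const_mx.
  - exact: signs_norm.
apply: rorthomx_refl_ind Xo => [|Y a ar a1 [A [B [K [Au Bu Ke YE]]]]].
  have u1 : unitary2 (1%:M : 'M[C]_2) by rewrite /unitary2 mxconj1 trmx1 mulmx1.
  exists 1%:M, 1%:M, 1%:M; split; auto.
  have -> : kron 1%:M 1%:M = 1%:M :> 'M[C]_4.
    by rewrite /kron mx2_1 tensmx_diag2 !mulr1 mx4_1.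
  by rewrite mul1mx.
have [b [br b1 bE]] : exists b, [/\ real_mx b, b *m b^T = 1%:M &
    K *m refl a = refl b *m K].
  case: Ke => ->; first by exists a; rewrite mul1mx mulmx1.
  exists (a *m diag_mx signs); rewrite signs_refl; split=> //.
    apply: real_mxM => //; rewrite /real_mx /mxconj map_diag_mx; congr diag_mx.
    by apply/rowP; elim/ord4P; rewrite !mxE /= ?rmorphN rmorph1.
  by rewrite trmx_mul tr_diag_mx mulmxA -[a *m _ *m _]mulmxA signs_sqr mulmx1.
have [A' [B' [Au' Bu' bM]]] := magic_refl br b1.
exists (A *m A'), (B *m B'), (diag_mx signs *m K); split.
- exact: unitary2M.
- exact: unitary2M.
- by case: Ke => ->; rewrite ?mulmx1 ?signs_sqr; auto.
- have -> : magic *m (Y *m refl a) = kron A B *m (magic *m refl b) *m K.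
    by rewrite [LHS]mulmxA [X in X *m _]YE -!mulmxA bE.
  by rewrite bM kronM !mulmxA.
Qed.

End Circuits.

(** * Assembly of the circuit *)

Theorem theorem1 (R : realType) (U : 'M[R[i]]_4) :
  unitary U ->
  exists (c : R[i]) (gs : seq 'M[R[i]]_4),
    `|c| = 1 /\
    (forall G, G \in gs -> elementary_gate G) /\
    (size gs <= 23)%N /\
    (count (@is_cnot R) gs <= 4)%N /\
    U = c *: circuit gs.
Proof.
move=> Uu; have Uu' : U *m dag U = 1%:M := Uu.
have [E EE0] : exists E, E = magic R by eexists.
have EE : E *m dag E = 1%:M by rewrite EE0 magic_unitary.
have EE' := mulmx1C EE.
have /unitary_orth_diag_orth [X [Y [d [Xo Yo d1 VE]]]] :
    (dag E *m U *m E) *m dag (dag E *m U *m E) = 1%:M.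
  rewrite !dagM dagK -!mulmxA [E *m (dag E *m _)]mulmxA EE mul1mx.
  by rewrite [U *m _]mulmxA Uu' mul1mx.
have [A [B [e [Au Bu e1]]]] := magic_rorthomx Xo.
rewrite -EE0 => XE.
have [A' [B' [e' [Au' Bu' e1']]]] := magic_rorthomx Yo.
rewrite -EE0 => YE.
have YT : Y^T = dag Y by rewrite /dag Yo.2.
(* All diagonal factors commute and merge into [f], including the phases of the magic basis, which
   leaves [bellC] on both sides. *)
pose f : 'rV[R[i]]_4 := \row_i (phase R 0 i * e 0 i * d 0 i
  * Num.conj (e' 0 i) * Num.conj (phase R 0 i)).
have UE : U = kron A B *m (bellC R *m diag_mx f *m dag (bellC R))
    *m kron (dag A') (dag B').
  rewrite -dag_kron.
  (* As [Y] is real, [Y^T] is its adjoint, so the right factor is the adjoint of [E *m Y] and is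
     handled like the left one. *)
  transitivity (E *m X *m diag_mx d *m dag (E *m Y)).
    rewrite dagM -YT -[U]mul1mx -EE -[U]mulmx1 -EE -!mulmxA; congr (_ *m _).
    by rewrite !mulmxA VE.
  rewrite XE YE !dagM dag_diag EE0 /magic dagM dag_diag -!mulmxA; congr (_ *m (_ *m _)).
  rewrite !mulmxA !mulmx_diag; congr (diag_mx _ *m _ *m _).
  by apply/rowP => i; rewrite !mxE.
have f1 i : `|f 0 i| = 1.
  rewrite mxE !normrM !norm_conjC phase_norm e1 e1' !mulr1 mul1r.
  by apply/eqP/unit_normP/d1.
have dag2 (D : 'M_2) : unitary2 D -> unitary2 (dag D) by exact: dag_unitary.
have [c [gs [c1 [gsE [gsn [gsk ->]]]]]] : realizable 21 4 U.
  rewrite UE; apply: (@realizableM _ 15 4 6 0); last by apply: realizable_local; apply: dag2.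
  apply: (@realizableM _ 6 0 9 4); first exact: realizable_local.
  apply: (@realizableM _ 7 3 2 1); last exact: (realizable_bellC R).2.
  apply: (@realizableM _ 2 1 5 2); first exact: (realizable_bellC R).1.
  exact: realizable_diag.
by exists c, gs; do !split=> //; apply: leq_trans gsn _.
Qed.
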